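(* Let $d\geq 2$ be an integer, let $m^{(d)}_{k,n}$ ($k\in\mathbb{Z}$, $n\in\mathbb{Z}_{\geq 0}$) be the entries of the Motzkin triangle of order $d$, let $b^{(2d-1)}_{k,n}$ be the generalised binomial coefficients of order $2d-1$, and let $c^{(2d-1)}_{k,n}$ be the entries of the Catalan triangle of order $2d-1$. Then: 1. For every $n\geq 0$, $$([d-1]_q+[d]_q)^n=\sum_{k>0}m_{k,n}^{(d)}[k]_q .$$ 2. For every $k\in\mathbb{Z}$ and $n\geq 0$, $$m_{k,n}^{(d)}=b_{2k-2,n}^{(2d-1)}-b_{2k+2,n}^{(2d-1)} .$$ 3. For every $k\in\mathbb{Z}$ and $n\geq 0$, $$m_{k,n}^{(d)}=c_{2k-1,n}^{(2d-1)}+c_{2k+1,n}^{(2d-1)} .$$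
   Context: Let $q$ be an indeterminate and, for an integer $k\geq 1$, let $[k]_q=\frac{q^k-q^{-k}}{q-q^{-1}}=q^{1-k}+q^{3-k}+\dots+q^{k-3}+q^{k-1}$. For an integer $e\geq 2$, the generalised binomial coefficients $b^{(e)}_{k,n}$ of order $e$ ($k\in\mathbb{Z}$, $n\in\mathbb{Z}_{\geq 0}$) are the integers defined by $[e]_q^n=\sum_{k\in\mathbb{Z}}b_{k,n}^{(e)}q^k$. For an integer $e\geq 2$, the Catalan triangle of order $e$ is the family of integers $c^{(e)}_{k,n}$ ($k\in\mathbb{Z}$, $n\in\mathbb{Z}_{\geq0}$) defined by $c^{(e)}_{-1,0}=-1$, $c_{1,0}^{(e)}=1$, $c_{i,0}^{(e)}=0$ for all $i\neq-1,1$, and the recurrence $$c_{k,n+1}^{(e)}=c_{k-(e-1),n}^{(e)}+c_{k-(e-3),n}^{(e)}+\dots+c_{k+e-3,n}^{(e)}+c_{k+e-1,n}^{(e)}$$ (a sum of $e$ terms, with first indices in steps of $2$). For $d\geq 2$, the Motzkin triangle of order $d$ is the family of integers $m^{(d)}_{k,n}$ ($k\in\mathbb{Z}$, $n\in\mathbb{Z}_{\geq0}$) defined by $m^{(d)}_{-1,0}=-1$, $m_{1,0}^{(d)}=1$, $m_{i,0}^{(d)}=0$ for all $i\neq-1,1$, and the recurrence $$m_{k,n+1}^{(d)}=m_{k-(d-1),n}^{(d)}+m_{k-(d-2),n}^{(d)}+\dots+m_{k+d-2,n}^{(d)}+m_{k+d-1,n}^{(d)}$$ (a sum of $2d-1$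 terms, with first indices in steps of $1$). For fixed $n$ only finitely many entries of each triangle are non-zero. *)

(* Defs.v *)
From HB Require Import structures.
From mathcomp Require Import all_boot all_order all_algebra.
From mathcomp Require Import finmap.
From mathcomp Require Import boolp classical_sets functions cardinality fsbigop.
From mathcomp Require Import zify ring.

Set Implicit Arguments.
Unset Strict Implicit.
Unset Printing Implicit Defensive.

Import Order.TTheory GRing.Theory Num.Theory.

Local Open Scope classical_set_scope.
Local Open Scope ring_scope.

(* Laurent polynomials Z[q, q^-1] are viewed inside their field of fractions
   Q(q) = Frac Z[q]; an exponent in int makes "^" the integer power. *)
Definition qvar : {fraction {poly int}} := tofrac 'X.

Definition qint (k : int) : {fraction {poly int}} :=
  (qvar ^ k - qvar ^ (- k)) / (qvar - qvar^-1).

(* \sum_(k \in A) is the sum of a finitely supported family indexed by A. *)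
Definition is_gbinom (e n : nat) (b : int -> int) : Prop :=
  finite_set [set k | b k != 0] /\
  qint e%:Z ^+ n = \sum_(k \in [set: int]) (b k)%:~R * qvar ^ k.

(* gbinom e k n is b_{k,n}^{(e)}: the family satisfying the defining identity,
   which exists and is unique by gbinomP and is_gbinom_inj. *)
Definition gbinom (e : nat) (k : int) (n : nat) : int :=
  xget (fun=> 0) [set b | is_gbinom e n b] k.

Fixpoint catalan (e : nat) (k : int) (n : nat) : int :=
  if n is n'.+1 then
    \sum_(i < e) catalan e (k - (e%:Z - 1) + 2 * i%:Z) n'
  else if k == 1 then 1 else if k == -1 then -1 else 0.

Fixpoint motzkin (d : nat) (k : int) (n : nat) : int :=
  if n is n'.+1 then
    \sum_(i < 2 * d - 1) motzkin d (k - (d%:Z - 1) + i%:Z) n'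
  else if k == 1 then 1 else if k == -1 then -1 else 0.

Lemma qvar_neq0 : qvar != 0.
Proof. by rewrite tofrac_eq0 polyX_eq0. Qed.

Lemma qvarBV_neq0 : qvar - qvar^-1 != 0.
Proof.
apply: contra qvar_neq0 => /eqP h.
have : (qvar - qvar^-1) * qvar = 0 by rewrite h mul0r.
rewrite mulrBl mulVf ?qvar_neq0// -expr2 /qvar -tofracXn -tofrac1 -tofracB.
move/eqP; rewrite tofrac_eq0 => /eqP /(congr1 (fun p : {poly int} => p`_2)).
by rewrite coefB coefXn coef1 coef0.
Qed.

Lemma qintE (e : nat) :
  qint e%:Z = \sum_(i < e) qvar ^ (1 - e%:Z + 2 * i%:Z).
Proof.
apply: (mulIf qvarBV_neq0); rewrite divfK ?qvarBV_neq0//.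
rewrite mulr_suml.
under eq_bigr => i _ do rewrite mulrBr -exprN1 -{2}[qvar]expr1z -!expfzDr ?qvar_neq0//.
rewrite (eq_bigr (fun i : 'I_e => qvar ^ (- e%:Z + 2 * (i.+1)%:Z)
                               - qvar ^ (- e%:Z + 2 * i%:Z))); last first.
  by move=> i _; congr (_ ^ _ - _ ^ _); lia.
rewrite -(big_mkord xpredT (fun i => qvar ^ (- e%:Z + 2 * (i.+1)%:Z)
                               - qvar ^ (- e%:Z + 2 * i%:Z))).
rewrite telescope_sumr//; congr (_ ^ _ - _ ^ _); lia.
Qed.

Lemma shiftP (N M : nat) (k : int) : - N%:Z <= k < M%:Z - N%:Z ->
  k \in [seq (i%:Z - N%:Z : int) | i <- iota 0 M].
Proof.
move=> hk; apply/mapP; exists (absz (k + N%:Z)); last by lia.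
by rewrite mem_iota; lia.
Qed.

(* A Laurent polynomial with exponents in [-N, M - N) is q^-N times a
   polynomial of degree < M. *)
Lemma laurentE (b : int -> int) (N M : nat) :
  (forall k : int, b k != 0 -> - N%:Z <= k < M%:Z - N%:Z) ->
  \sum_(k \in [set: int]) (b k)%:~R * qvar ^ k =
  qvar ^ (- N%:Z) * tofrac (\poly_(i < M) b (i%:Z - N%:Z)).
Proof.
move=> hb.
pose s := [seq (i%:Z - N%:Z : int) | i <- iota 0 M].
rewrite (fsbigE s)//=; first last.
- move=> k _ ks; suff -> : b k = 0 by rewrite mul0r.
  by apply/eqP; apply: contraNT ks => /hb /shiftP.
- by rewrite map_inj_uniq ?iota_uniq// => i j; lia.
under eq_bigl => i do rewrite in_setT.
have -> : s = [seq (i%:Z - N%:Z : int) | i <- index_iota 0 M] by rewrite /index_iota subn0.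
rewrite big_map big_mkord.
rewrite poly_def rmorph_sum mulr_sumr; apply: eq_bigr => i _ /=.
rewrite -mul_polyC tofracM tofracXn expfzDr ?qvar_neq0// -exprnP.
by rewrite -[X in X%:P]intz rmorph_int rmorph_int; ring.
Qed.

Lemma is_gbinom_ex (e n : nat) : (0 < e)%N -> exists b, is_gbinom e n b.
Proof.
move=> e0; pose N := (n * e.-1)%N.
pose P : {poly int} := (\sum_(i < e) 'X^(2 * i)) ^+ n.
pose b (k : int) : int := if 0 <= k + N%:Z then P`_(absz (k + N%:Z)) else 0.
have hb k : b k != 0 -> - N%:Z <= k < (size P)%:Z - N%:Z.
  rewrite /b; case: ifP => [k0 h|]; last by rewrite eqxx.
  suff : (absz (k + N%:Z)%R < size P)%N by lia.
  by rewrite ltnNge; apply: contra h => /leq_sizeP/(_ _ (leqnn _)) ->.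
exists b; split.
  apply: (@sub_finite_set _ _ [set` [seq (i%:Z - N%:Z : int) | i <- iota 0 (size P)]]).
    by move=> k /hb /shiftP.
  exact: finite_seq.
rewrite (laurentE hb) qintE.
have -> : \poly_(i < size P) b (i%:Z - N%:Z) = P.
  apply/polyP => i; rewrite coef_poly; case: ltnP => hi.
    by rewrite /b subrK absz_nat.
  by rewrite nth_default.
rewrite /P tofracXn rmorph_sum.
have -> : qvar ^ (- N%:Z) = (qvar ^ (1 - e%:Z)) ^+ n.
  by rewrite [RHS]exprnP exprz_exp; congr (_ ^ _); rewrite /N; nia.
rewrite -exprMn mulr_sumr; congr (_ ^+ _); apply: eq_bigr => i _ /=.
by rewrite tofracXn expfzDr ?qvar_neq0.
Qed.

Lemma gbinomP (e n : nat) : (0 < e)%N -> is_gbinom e n (fun k => gbinom e k n).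
Proof. by move=> e0; have [b hb] := is_gbinom_ex n e0; exact: (xgetI _ hb). Qed.

Lemma is_gbinom_inj (e n : nat) (b b' : int -> int) :
  is_gbinom e n b -> is_gbinom e n b' -> b = b'.
Proof.
have bound (c : int -> int) : finite_set [set k | c k != 0] ->
    exists N : nat, forall k, c k != 0 -> (absz k < N)%N.
  move=> /finite_seqP[s hs]; exists (\max_(i <- s) absz i).+1 => k ck.
  have ks : k \in s by have : [set` s] k by rewrite -hs.
  by rewrite ltnS (big_rem k ks) leq_maxl.
move=> [/bound[N1 h1] e1] [/bound[N2 h2] e2].
pose N := (N1 + N2)%N.
have g1 k : b k != 0 -> - N%:Z <= k < (2 * N)%:Z - N%:Z by move/h1; lia.
have g2 k : b' k != 0 -> - N%:Z <= k < (2 * N)%:Z - N%:Z by move/h2; lia.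
have := etrans (esym e1) e2; rewrite (laurentE g1) (laurentE g2).
move/(mulfI (expfz_neq0 _ qvar_neq0))/eqP; rewrite tofrac_eq => /eqP hP.
apply/funext => k.
have [hk|hk] := boolP (- N%:Z <= k < (2 * N)%:Z - N%:Z); last first.
  have -> : b k = 0 by apply/eqP; apply: contraNT hk => /g1.
  by apply/esym/eqP; apply: contraNT hk => /g2.
move/(congr1 (fun p : {poly int} => p`_(absz (k + N%:Z)))): hP.
rewrite !coef_poly ifT; last by lia.
have -> : Posz (absz (k + N%:Z)) - N%:Z = k by lia.
by rewrite ifT; last by lia.
Qed.

(* Main.v *)
Require Import Defs.
From mathcomp Require Import all_boot all_order all_algebra.
From mathcomp Require Import classical_sets fsbigop.
From mathcomp Require Import finmap boolp functions cardinality.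
From mathcomp Require Import zify ring.

(** Everything is read off generating functions.  Write L(f) for the Laurent
    polynomial with coefficients f k.  A recurrence that adds up translates of
    a row multiplies L by the Laurent polynomial recording the translations
    ([laurent_translates]).

    For the Motzkin triangle this factor is
    S = q^(d-1) + q^(d-2) + ... + q^(1-d), which is also [d-1]_q + [d]_q: both
    become the same telescoping sum once multiplied by q - q^-1
    ([qintD_pred]).  The initial row has generating function q - q^-1, hence
    row n has generating function (q - q^-1) S^n.  Each row is moreover odd in
    k, so the terms in k and -k of its generating function combine into
    (q - q^-1) m_k [k]_q; dividing by q - q^-1 gives the first claim.

    For the binomial coefficients of order e the factor is [e]_q, so they
    satisfy the recurrence of the Catalan triangle of the same order
    ([gbinomS]).  That recurrence moves the index in steps of 2; for
    e = 2d - 1, along the indices of a fixed parity it becomes the Motzkin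
    recurrence in steps of 1.  The last two claims therefore follow from this
    linear recurrence by comparing initial rows. *)

Set Implicit Arguments.
Unset Strict Implicit.
Unset Printing Implicit Defensive.

Import Order.TTheory GRing.Theory Num.Theory.

Local Open Scope classical_set_scope.
Local Open Scope ring_scope.

(** * Finitely supported sums over the integers *)

Definition fin_supp (f : int -> int) : Prop := finite_set [set k | f k != 0].

Definition laurent (f : int -> int) : {fraction {poly int}} :=
  \sum_(k \in [set: int]) (f k)%:~R * qvar ^ k.

(** One finite set containing all the supports turns both sides into ordinary
    finite double sums; for an infinite support the sum over the integers is 0
    by convention and additivity would fail. *)
Lemma fsum_exchange (V : nmodType) (I : choiceType) (A : set I) (m : nat)
    (F : 'I_m -> I -> V) :
  finite_set A -> (forall i k, ~ A k -> F i k = 0) ->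
  \sum_(k \in [set: I]) \sum_(i < m) F i k =
  \sum_(i < m) \sum_(k \in [set: I]) F i k.
Proof.
move=> finA F0.
have toA (G : I -> V) : (forall k, ~ A k -> G k = 0) ->
    \sum_(k \in [set: I]) G k = \sum_(k <- fset_set A) G k.
  move=> G0; rewrite -fsbig_finite//; apply/esym/fsbig_widen => // k [_ Ak].
  exact: G0.
rewrite toA => [|k Ak]; last by apply: big1 => i _; exact: F0.
rewrite exchange_big; apply: eq_bigr => i _ /=.
by rewrite toA// => k; exact: F0.
Qed.

Lemma finite_translated_supports (m : nat) (a : nat -> int) (f : int -> int) :
  fin_supp f ->
  finite_set (\bigcup_(i in `I_m) [set k | f (k - a i) != 0]).
Proof.
move=> finf; apply: bigcup_finite => // i _.
apply: (@sub_finite_set _ _ ((fun k => k + a i) @` [set k | f k != 0])).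
  by move=> k /= fk; exists (k - a i); rewrite ?subrK.
exact: finite_image.
Qed.

Lemma fin_supp_sum_translates (m : nat) (a : nat -> int) (f : int -> int) :
  fin_supp f -> fin_supp (fun k => \sum_(i < m) f (k - a i)).
Proof.
move=> finf; apply: (sub_finite_set _ (finite_translated_supports m a finf)) => k /= fk.
apply: contrapT => nk; move/eqP: fk; apply; apply: big1 => i _.
by apply: contrapT => /eqP fi; apply: nk; exists i => /=.
Qed.

(** Reindexing by k + a i pulls a factor q^(a i) out of each translate; this
    is what turns a recurrence on rows into a product. *)
Lemma laurent_translates (m : nat) (a : nat -> int) (f : int -> int) :
  fin_supp f ->
  laurent (fun k => \sum_(i < m) f (k - a i)) =
  (\sum_(i < m) qvar ^ a i) * laurent f.
Proof.
move=> finf; rewrite /laurent.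
under eq_fsbigr => k _ do rewrite rmorph_sum mulr_suml.
rewrite (fsum_exchange (finite_translated_supports m a finf)); last first.
  move=> i k nk /=; suff -> : f (k - a i) = 0 by rewrite mul0r.
  by apply: contrapT => /eqP fi; apply: nk; exists i => /=.
rewrite mulr_suml; apply: eq_bigr => i _ /=.
rewrite (@reindex_fsbigT _ _ _ _ _ (fun k => k + a i)); last first.
  by exists (fun k => k - a i) => k; rewrite ?addrK ?subrK.
rewrite mulr_fsumr; apply: eq_fsbigr => k _.
by rewrite addrK expfzDr ?qvar_neq0//; ring.
Qed.

(** The terms of an odd family in k and -k combine into a multiple of
    [k]_q (q - q^-1) = q^k - q^-k. *)
Lemma fsum_qint_odd (f : int -> int) :
  fin_supp f -> (forall k, f (- k) = - f k) ->
  \sum_(k \in [set k : int | 0 < k]) (f k)%:~R * qint k =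
  laurent f / (qvar - qvar^-1).
Proof.
move=> finf fN; apply: (mulIf qvarBV_neq0); rewrite divfK ?qvarBV_neq0//.
rewrite mulr_fsuml.
(* T 0 and T 1 are the two halves of the left-hand sum, the terms in q^k and
   in q^-k, for k > 0. *)
pose T (i : 'I_2) (k : int) : {fraction {poly int}} :=
  if 0 < k then (if i == 0 then (f k)%:~R * qvar ^ k
                 else - ((f k)%:~R * qvar ^ (- k))) else 0.
rewrite fsbig_mkcond (eq_fsbigr (fun k => \sum_(i < 2) T i k)); last first.
  move=> k _; rewrite /patch !big_ord_recl big_ord0 addr0 /T /=.
  have [k0|k0] := boolP (0 < k); last by rewrite memNset ?addr0//; exact/negP.
  by rewrite mem_set// /qint -mulrA divfK ?qvarBV_neq0// mulrBr.
have T0 i k : ~ [set k | f k != 0] k -> T i k = 0.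
  by move=> /= /negP; rewrite negbK /T => /eqP ->; rewrite !mul0r oppr0 !if_same.
rewrite (fsum_exchange finf T0) !big_ord_recl big_ord0 addr0 /=.
(* Negating k in T 1 makes it the part of the right-hand side with k < 0. *)
pose U (i : 'I_2) (k : int) : {fraction {poly int}} :=
  if i == 0 then T 0 k else T (lift ord0 ord0) (- k).
rewrite [X in _ + X](@reindex_fsbigT _ _ _ _ _ (fun k : int => - k)); last first.
  by exists (fun k => - k) => k; rewrite opprK.
transitivity (\sum_(i < 2) \sum_(k \in [set: int]) U i k).
  by rewrite !big_ord_recl big_ord0 addr0.
rewrite -(fsum_exchange finf); last first.
  move=> i k fk; rewrite /U; case: ifP => _; first exact: T0.
  by apply: T0 => /=; rewrite fN oppr_eq0.
apply: eq_fsbigr => k _.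
rewrite !big_ord_recl big_ord0 addr0 /U /T /= opprK fN oppr_gt0.
case: (ltgtP k 0) => [k0|k0|->].
- by rewrite add0r rmorphN mulNr opprK.
- by rewrite addr0.
- suff -> : f 0 = 0 by rewrite mul0r addr0.
  have f0N : f 0 = - f 0 :> int by rewrite -fN oppr0.
  by move: (f 0) f0N => x; lia.
Qed.

(** * The generalised binomial recurrence *)

Lemma gbinom0 (e : nat) (k : int) :
  (0 < e)%N -> gbinom e k 0 = (k == 0)%:R.
Proof.
move=> e0; suff H : is_gbinom e 0 (fun k => (k == 0)%:R).
  by have /(congr1 (@^~ k)) := is_gbinom_inj (gbinomP 0 e0) H.
split.
  apply: (sub_finite_set _ (finite_set1 0)) => j /=.
  by have [->|_] := eqVneq j 0; rewrite ?eqxx.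
rewrite (fsbigE [:: 0])//; last first.
  by move=> j _; rewrite inE => /negPf ->; rewrite mul0r.
by rewrite big_cons big_nil in_setT /= addr0 mulr1.
Qed.

(** Both sides are coefficient families of [e]_q^(n+1), and these are
    unique. *)
Lemma gbinomS (e n : nat) (k : int) : (0 < e)%N ->
  gbinom e k n.+1 = \sum_(i < e) gbinom e (k - (e%:Z - 1) + 2 * i%:Z) n.
Proof.
move=> e0; have [fin eqn] := gbinomP n e0.
pose a (i : nat) : int := e%:Z - 1 - 2 * i%:Z.
suff H : is_gbinom e n.+1 (fun k => \sum_(i < e) gbinom e (k - a i) n).
  have /(congr1 (@^~ k)) /= -> := is_gbinom_inj (gbinomP n.+1 e0) H.
  by apply: eq_bigr => i _; congr gbinom; rewrite /a; lia.
split; first exact: (@fin_supp_sum_translates e a (fun k => gbinom e k n)).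
have := @laurent_translates e a (fun k => gbinom e k n) fin.
rewrite /laurent => ->; rewrite exprS -eqn; congr (_ * _).
rewrite qintE (reindex_inj rev_ord_inj); apply: eq_bigr => i _ /=.
by congr (_ ^ _); rewrite /a; have := ltn_ord i; lia.
Qed.

(** * Motzkin rows and their generating functions *)

Lemma motzkinN (d n : nat) (k : int) : motzkin d (- k) n = - motzkin d k n.
Proof.
elim: n k => [|n IHn] k /=.
  have -> : (- k == 1) = (k == -1) by lia.
  have -> : (- k == -1) = (k == 1) by lia.
  by have [->|_] := eqVneq k 1; last by case: eqVneq.
rewrite (reindex_inj rev_ord_inj) -sumrN; apply: eq_bigr => i _ /=.
by rewrite -IHn; congr motzkin; have := ltn_ord i; lia.
Qed.

Lemma motzkinS_translates (d n : nat) (k : int) :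
  motzkin d k n.+1 =
  \sum_(i < 2 * d - 1) motzkin d (k - (d%:Z - 1 - i%:Z)) n.
Proof. by apply: eq_bigr => i _; congr motzkin; lia. Qed.

Lemma fin_supp_motzkin (d n : nat) : fin_supp (fun k => motzkin d k n).
Proof.
elim: n => [|n IHn].
  apply: (@sub_finite_set _ _ [set 1; -1]) => // k /=.
  have [->|_] := eqVneq k 1; first by left.
  by have [->|_] := eqVneq k (-1); [right|rewrite eqxx].
rewrite /fin_supp; under eq_set => k do rewrite motzkinS_translates.
exact: (@fin_supp_sum_translates _ (fun i => d%:Z - 1 - i%:Z)
          (fun k => motzkin d k n)).
Qed.

Lemma laurent_motzkin (d n : nat) :
  laurent (fun k => motzkin d k n) =
  (\sum_(i < 2 * d - 1) qvar ^ (d%:Z - 1 - i%:Z)) ^+ n * (qvar - qvar^-1).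
Proof.
elim: n => [|n IHn].
  rewrite /laurent (fsbigE [:: 1; -1])//; last first.
    by move=> k _ /=; rewrite !inE negb_or => /andP[/negPf -> /negPf ->]; rewrite mul0r.
  by rewrite !big_cons big_nil !in_setT /= addr0 !mul1r mulN1r exprN1 expr1z.
rewrite exprS -mulrA -IHn -(@laurent_translates _ (fun i => d%:Z - 1 - i%:Z));
  last exact: fin_supp_motzkin.
by congr laurent; apply/funext => k; exact: motzkinS_translates.
Qed.

(** The exponents on the right are the shifts occurring in the Motzkin
    recurrence.  After multiplication by q - q^-1 that sum telescopes through u_j = q^j + q^(j-1), because
    u_j - u_(j-1) = q^j - q^(j-2). *)
Lemma qintD_pred (d : nat) : (0 < d)%N ->
  qint (d%:Z - 1) + qint d%:Z =
  \sum_(i < 2 * d - 1) qvar ^ (d%:Z - 1 - i%:Z).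
Proof.
move=> d0; apply: (mulIf qvarBV_neq0).
rewrite mulrDl !divfK ?qvarBV_neq0// mulr_suml.
pose u (i : nat) := qvar ^ (d%:Z - i%:Z) + qvar ^ (d%:Z - i%:Z - 1).
rewrite (eq_bigr (fun i : 'I__ => - u i.+1 - - u i)); last first.
  move=> i _; rewrite mulrBr -exprN1 -{2}[qvar]expr1z -!expfzDr ?qvar_neq0// /u.
  have -> : d%:Z - i.+1%:Z = d%:Z - i%:Z - 1 by lia.
  have -> : d%:Z - 1 - i%:Z + 1 = d%:Z - i%:Z by lia.
  have -> : d%:Z - 1 - i%:Z - 1 = d%:Z - i%:Z - 1 - 1 by lia.
  by ring.
rewrite -(big_mkord xpredT (fun i => - u i.+1 - - u i)) telescope_sumr// /u.
have -> : d%:Z - (2 * d - 1)%N%:Z = - (d%:Z - 1) by lia.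
have -> : - (d%:Z - 1) - 1 = - d%:Z by lia.
by rewrite subr0; ring.
Qed.

Theorem proposition4p3 (d : nat) (hd : (2 <= d)%N) :
  (forall n : nat,
     (qint (d%:Z - 1) + qint d%:Z) ^+ n =
     \sum_(k \in [set k : int | 0 < k]) (motzkin d k n)%:~R * qint k)
  /\ (forall (k : int) (n : nat),
     motzkin d k n =
     gbinom (2 * d - 1)%N (2 * k - 2) n - gbinom (2 * d - 1)%N (2 * k + 2) n)
  /\ (forall (k : int) (n : nat),
     motzkin d k n =
     catalan (2 * d - 1)%N (2 * k - 1) n + catalan (2 * d - 1)%N (2 * k + 1) n).
Proof.
have d0 : (0 < d)%N by lia.
have e0 : (0 < 2 * d - 1)%N by lia.
split; last split.
- move=> n; rewrite (fsum_qint_odd (fin_supp_motzkin d n) (motzkinN d n)).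
  by rewrite laurent_motzkin mulfK ?qvarBV_neq0// qintD_pred.
- move=> k n; elim: n k => [|n IHn] k.
    rewrite !gbinom0// /=.
    have -> : (2 * k - 2 == 0) = (k == 1) by lia.
    have -> : (2 * k + 2 == 0) = (k == -1) by lia.
    by case: eqVneq => [->|_] //; case: eqVneq.
  rewrite !gbinomS// -sumrB /=; apply: eq_bigr => i _; rewrite IHn.
  by congr (gbinom _ _ _ - gbinom _ _ _); lia.
- move=> k n; elim: n k => [|n IHn] k.
    rewrite /=.
    have -> : (2 * k - 1 == 1) = (k == 1) by lia.
    have -> : (2 * k - 1 == -1) = (k == 0) by lia.
    have -> : (2 * k + 1 == 1) = (k == 0) by lia.
    have -> : (2 * k + 1 == -1) = (k == -1) by lia.
    have [->|_] := eqVneq k 1; first by [].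
    by have [->|_] := eqVneq k 0; last by rewrite add0r.
  rewrite /= -big_split; apply: eq_bigr => i _; rewrite IHn.
  by congr (catalan _ _ _ + catalan _ _ _); lia.
Qed.
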